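(* Let $H$, $N$, $m$, $H_p$, $H_e$ be as defined in the context and suppose that $N>2$ and $m<2$ (so that both horizons exist). Then there exists one and only one $z_0>-1$ such that $$H_e(z)>H_p(z)\ \text{ for every } z\in(z_0,\infty),\qquad H_e(z_0)=H_p(z_0),\qquad H_e(z)<H_p(z)\ \text{ for every } z\in(-1,z_0).$$
   Context: Units are $c=G=1$. The universe is a homogeneous and isotropic (Robertson-Walker) expanding universe filled with countably many non-interacting constituents with state equations $p_i=w_i\rho_i$, $i\ge1$, where the $w_i$ are constant. Put $n_i=3(1+w_i)$ (arbitrary real constants). Let $H_0>0$ be the present value of the Hubble parameter and $\Omega_{i0}$ the present dimensionless energy density of the $i$-th constituent. The curvature is included as one of the constituents (with exponent $2$), so that $\sum_{i=1}^\infty\Omega_{i0}=1$. Finitely many state equations are covered by taking $\Omega_{i0}=0$ for all $i$ beyond some index. The Hubble parameter as a function of the redshift $z$ is $$H(z)=H_0\sqrt{\sum_{i=1}^\infty\Omega_{i0}(1+z)^{n_i}} .$$ Since the universe is expanding, $H$ is positive for $z>-1$. Standing hypothesis on $H$: with $S_n(z)=\sum_{i=1}^n\Omega_{i0}(1+z)^{n_i}$, the derivatives $S_n'$ converge uniformly to a function $G$ on $I=[-1,\infty)$, i.e. $\sup_{z\in I}|S_n'(z)-G(z)|\to0$ as $n\to\infty$. $N$ denotes the highest and $m$ the lowest of the exponents $n_i$ which appear in $H(z)$; they are allowed to be $\pm\infty$ if the set $\{n_i\}$ is not bounded above, respectively below. The particle horizon and the event horizon at redshift $z>-1$ are $$H_p(z)=\frac1{1+z}\int_z^\infty\frac{dx}{H(x)},\qquad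 H_e(z)=\frac1{1+z}\int_{-1}^z\frac{dx}{H(x)}.$$ *)

(* Defs.v *)
From Stdlib Require Import Reals.
From Coquelicot Require Import Coquelicot.
Open Scope R_scope.

(* Constituents are indexed from 0, so index i here is i + 1 in the
   mathematical numbering; [w i] is the constant in [p = w * rho]. *)
Definition exponent (w : nat -> R) (i : nat) : R := 3 * (1 + w i).

(* All functions of the redshift z are only meaningful for z > -1, where
   [Rpower (1 + z)] is the genuine real power.  *)
Definition density_term (Omega w : nat -> R) (z : R) (i : nat) : R :=
  Omega i * Rpower (1 + z) (exponent w i).

(* [sum_n] includes its last index: this is S_(k+1). *)
Definition density_sum (Omega w : nat -> R) (k : nat) (z : R) : R :=
  sum_n (density_term Omega w z) k.

Definition hubble (H0 : R) (Omega w : nat -> R) (z : R) : R :=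
  H0 * sqrt (Series (density_term Omega w z)).

(* The term derivatives are in general singular at z = -1 (exponents < 1), so
   the supremum is taken over the points z > -1.  When the partial sums do have
   continuous one-sided derivatives at -1, adding that endpoint does not change
   the supremum. *)
Definition derivatives_cv_unif (Omega w : nat -> R) (G : R -> R) : Prop :=
  forall eps : posreal,
    eventually (fun k => forall z : R, -1 < z ->
      Rabs (Derive (density_sum Omega w k) z - G z) < eps).

(* Distinct constituents may share an exponent, and their contributions may
   then cancel: an exponent e appears in H when the total coefficient of
   (1 + z)^e is nonzero.  For pairwise distinct exponents this says that
   e = exponent w i for some i with Omega i <> 0. *)
Definition exponent_coef (Omega w : nat -> R) (e : R) : R :=
  Series (fun i => if Req_EM_T (exponent w i) e then Omega i else 0).

Definition appears (Omega w : nat -> R) (e : R) : Prop :=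
  exponent_coef Omega w e <> 0.

Definition highest_exponent (Omega w : nat -> R) : Rbar :=
  Lub_Rbar (appears Omega w).

Definition lowest_exponent (Omega w : nat -> R) : Rbar :=
  Glb_Rbar (appears Omega w).

(* Both integrals are improper; the one of the event horizon is improper at -1,
   where 1/H may be unbounded. *)
Definition particle_horizon_exists (H : R -> R) (z : R) : Prop :=
  ex_RInt_gen (fun x => / H x) (at_point z) (Rbar_locally p_infty).

Definition event_horizon_exists (H : R -> R) (z : R) : Prop :=
  ex_RInt_gen (fun x => / H x) (at_right (-1)) (at_point z).

Definition particle_horizon (H : R -> R) (z : R) : R :=
  / (1 + z) * RInt_gen (fun x => / H x) (at_point z) (Rbar_locally p_infty).

Definition event_horizon (H : R -> R) (z : R) : R :=
  / (1 + z) * RInt_gen (fun x => / H x) (at_right (-1)) (at_point z).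

(* Main.v *)
Require Import Defs.
From Stdlib Require Import Reals Lra Lia List Classical.
From Coquelicot Require Import Coquelicot.
Open Scope R_scope.

(* Uniform convergence of the [S_n'] on all of (-1, oo) makes each term
   derivative of large index bounded there, and a bounded monomial is constant:
   from some index on, every constituent has exponent 0 or 1 (or zero density).
   Hence H^2 is a finite combination of powers of x = 1 + z.  Positivity of H
   makes its extreme coefficients positive, so H^2 >= c x^N near oo with N > 2
   and H^2 >= c x^m near 0 with m < 2, and both horizons exist.  Finally
   (1 + z) (He z - Hp z) = 2 F z - (F(-1) + F(oo)) for any primitive F of 1/H,
   which is strictly increasing and changes sign. *)

(** * Finite sums of real powers and their total coefficients *)

(* Terms are (coefficient, exponent) pairs; an exponent may be repeated. *)
Definition gpoly (L : list (R * R)) (x : R) : R :=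
  fold_right (fun t s => fst t * Rpower x (snd t) + s) 0 L.

Definition gcoef (L : list (R * R)) (e : R) : R :=
  fold_right (fun t s => (if Req_EM_T (snd t) e then fst t else 0) + s) 0 L.

Definition remove_exponent (a : R) (L : list (R * R)) : list (R * R) :=
  filter (fun t => if Req_EM_T (snd t) a then false else true) L.

Lemma gpoly_app L1 L2 x : gpoly (L1 ++ L2) x = gpoly L1 x + gpoly L2 x.
Proof. induction L1 as [|t L1 IH]; simpl; [|rewrite IH]; ring. Qed.

Lemma gcoef_app L1 L2 e : gcoef (L1 ++ L2) e = gcoef L1 e + gcoef L2 e.
Proof. induction L1 as [|t L1 IH]; simpl; [|rewrite IH]; ring. Qed.

Lemma gpoly_remove_exponent a L x :
  gpoly L x = gcoef L a * Rpower x a + gpoly (remove_exponent a L) x.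
Proof.
  induction L as [|[c e] L IH]; simpl; [ring|].
  rewrite IH. destruct (Req_EM_T e a) as [->|Hne]; simpl; ring.
Qed.

Lemma gcoef_remove_exponent a L e :
  gcoef (remove_exponent a L) e = if Req_EM_T e a then 0 else gcoef L e.
Proof.
  induction L as [|[c b] L IH]; simpl.
  - destruct (Req_EM_T e a); reflexivity.
  - destruct (Req_EM_T b a) as [->|Hba]; simpl; rewrite IH;
      destruct (Req_EM_T e a) as [->|Hea]; try reflexivity.
    + destruct (Req_EM_T a e) as [Hae|_]; [congruence|ring].
    + destruct (Req_EM_T b a); [congruence|ring].
Qed.

(** Provides the decreasing measure for the induction in [gpoly_lim_lead]. *)
Lemma length_remove_exponent a L :
  Exists (fun t => snd t = a) L -> (length (remove_exponent a L) < length L)%nat.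
Proof.
  assert (Hle : forall L', (length (remove_exponent a L') <= length L')%nat).
  { intros L'. apply filter_length_le. }
  induction L as [|[c b] L IH]; intros HE; [inversion HE|].
  simpl. specialize (Hle L).
  destruct (Req_EM_T b a) as [_|Hba]; simpl.
  - unfold remove_exponent in *; lia.
  - apply Exists_cons in HE as [HE|HE]; [contradiction|].
    specialize (IH HE). unfold remove_exponent in *; lia.
Qed.

Lemma gcoef_nonzero_In L e : gcoef L e <> 0 -> In e (map snd L).
Proof.
  induction L as [|[c b] L IH]; simpl; [congruence|].
  destruct (Req_EM_T b e) as [->|Hbe]; [tauto|].
  intros H. right. apply IH. lra.
Qed.

(** * Leading term at infinity *)

(** Used to pick the largest exponent whose total coefficient is nonzero. Induction on the covering
    list: either [P] holds at [a] only, or the maximum over the points other than [a] is compared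
    with [a]. *)
Lemma finite_has_max (l : list R) (P : R -> Prop) :
  (forall x, P x -> In x l) -> (exists x, P x) ->
  exists m, P m /\ forall x, P x -> x <= m.
Proof.
  revert P. induction l as [|a l IH]; intros P HP [x Hx]; [destruct (HP x Hx)|].
  destruct (classic (exists y, P y /\ y <> a)) as [Hy|Hno].
  - destruct (IH (fun y => P y /\ y <> a)) as [m [[Hm _] Hmax]]; [|exact Hy|].
    + intros y [Py Hya]. destruct (HP y Py) as [Hay|Hl]; [congruence|assumption].
    + destruct (classic (P a)) as [Ha|Ha].
      * exists (Rmax a m). split.
        -- unfold Rmax; destruct (Rle_dec a m); assumption.
        -- intros y Py. destruct (Req_EM_T y a) as [->|Hya]; [apply Rmax_l|].
           apply Rle_trans with m; [now apply Hmax|apply Rmax_r].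
      * exists m. split; [assumption|]. intros y Py. apply Hmax.
        split; [assumption|congruence].
  - exists x. split; [assumption|]. intros y Py.
    assert (Heq : forall u, P u -> u = a).
    { intros u Pu. apply NNPP. intros Hu. apply Hno. now exists u. }
    rewrite (Heq x Hx), (Heq y Py). lra.
Qed.

Lemma is_lim_Rpower_neg (a : R) : a < 0 -> is_lim (fun x => Rpower x a) p_infty 0.
Proof.
  intros Ha. unfold Rpower.
  apply is_lim_comp with m_infty.
  - apply is_lim_exp_m.
  - replace m_infty with (Rbar_mult a p_infty).
    + apply (is_lim_scal_l ln a p_infty p_infty), is_lim_ln_p.
    + simpl. destruct (Rle_dec 0 a); [exfalso; lra|reflexivity].
  - exists 0. intros; discriminate.
Qed.

(** Dividing by [x^e] leaves exponents [b - e <= 0]: terms with [b = e] become constants, all others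
    tend to 0. *)
Lemma gpoly_lim_top L e :
  List.Forall (fun t => snd t <= e) L ->
  is_lim (fun x => gpoly L x * Rpower x (- e)) p_infty (gcoef L e).
Proof.
  induction L as [|[c b] L IH]; intros HF; simpl.
  - apply is_lim_ext with (fun _ => 0); [intros x; ring|apply is_lim_const].
  - apply Forall_cons_iff in HF as [Hb HF']; simpl in Hb.
    apply is_lim_ext with
      (fun x => c * Rpower x (b - e) + gpoly L x * Rpower x (- e)).
    { intros x. unfold Rminus. rewrite Rpower_plus. ring. }
    apply (is_lim_plus' _ _ p_infty (if Req_EM_T b e then c else 0)).
    + destruct (Req_EM_T b e) as [->|Hbe].
      * apply is_lim_ext with (fun _ => c); [|apply is_lim_const].
        intros x. rewrite Rminus_diag. unfold Rpower. rewrite Rmult_0_l, exp_0. ring.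
      * replace (Finite 0) with (Rbar_mult c 0) by (simpl; f_equal; ring).
        apply is_lim_scal_l, is_lim_Rpower_neg. lra.
    + now apply IH.
Qed.

(** Exponents above [e] may still be listed, with cancelling coefficients. Removing such an exponent
    altogether keeps the function and shortens the list, until [gpoly_lim_top] applies. *)
Lemma gpoly_lim_lead L e :
  (forall e', e < e' -> gcoef L e' = 0) ->
  is_lim (fun x => gpoly L x * Rpower x (- e)) p_infty (gcoef L e).
Proof.
  remember (length L) as n eqn:Hn. revert L Hn.
  induction n as [n IH] using (well_founded_induction Wf_nat.lt_wf).
  intros L Hn Htop.
  destruct (classic (Exists (fun t => e < snd t) L)) as [HE|HE].
  - apply Exists_exists in HE as [[c a] [Hin Ha]]; simpl in Ha.
    replace (gcoef L e) with (gcoef (remove_exponent a L) e).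
    2:{ rewrite gcoef_remove_exponent. destruct (Req_EM_T e a); [lra|reflexivity]. }
    apply is_lim_ext with (fun x => gpoly (remove_exponent a L) x * Rpower x (- e)).
    { intros x. rewrite (gpoly_remove_exponent a L), (Htop a Ha). ring. }
    apply IH with (length (remove_exponent a L)); [|reflexivity|].
    + subst n. apply length_remove_exponent, Exists_exists. now exists (c, a).
    + intros e' He'. rewrite gcoef_remove_exponent.
      destruct (Req_EM_T e' a); [reflexivity|now apply Htop].
  - apply gpoly_lim_top, Forall_forall. intros t Ht.
    apply Rnot_lt_le. intros Hlt. apply HE, Exists_exists. now exists t.
Qed.

(** Let [p] be the largest exponent with nonzero total coefficient, so [p >= e > B]. The quotient by
    [x^p] tends to that coefficient, which positivity of the sum makes positive. *)
Lemma gpoly_growth L B e :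
  (forall x, 0 < x -> 0 < gpoly L x) -> B < e -> gcoef L e <> 0 ->
  exists p c X, B < p /\ 0 < c /\ 0 < X /\
    forall x, X <= x -> c * Rpower x p <= gpoly L x.
Proof.
  intros Hpos HB He.
  destruct (finite_has_max (map snd L) (fun e => gcoef L e <> 0)) as [p [Hp Hmax]].
  { apply gcoef_nonzero_In. }
  { now exists e. }
  assert (Hlim : is_lim (fun x => gpoly L x * Rpower x (- p)) p_infty (gcoef L p)).
  { apply gpoly_lim_lead. intros e' He'. apply NNPP. intros Hne.
    specialize (Hmax e' Hne). lra. }
  assert (Hge : 0 <= gcoef L p).
  { apply (is_lim_le_loc (fun _ => 0) (fun x => gpoly L x * Rpower x (- p)) p_infty 0 (gcoef L p)).
    - exists 0. intros x Hx. apply Rlt_le, Rmult_lt_0_compat; [now apply Hpos|apply exp_pos].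
    - apply is_lim_const.
    - exact Hlim. }
  assert (Hc : 0 < gcoef L p / 2) by lra.
  apply is_lim_spec in Hlim.
  destruct (Hlim (mkposreal _ Hc)) as [X HX]; simpl in HX.
  (* Staying within half the limit keeps the quotient above the other half. The threshold lies
     strictly beyond [X] and is positive. *)
  exists p, (gcoef L p / 2), (Rmax X 0 + 1).
  pose proof (Rmax_l X 0). pose proof (Rmax_r X 0).
  repeat split; try lra.
  { specialize (Hmax e He). lra. }
  intros x Hx. specialize (HX x ltac:(lra)). apply Rabs_def2 in HX.
  replace (gpoly L x) with (gpoly L x * Rpower x (- p) * Rpower x p).
  2:{ rewrite Rmult_assoc, <- Rpower_plus, Rplus_opp_l, Rpower_O by lra. ring. }
  apply Rmult_le_compat_r; [apply Rlt_le, exp_pos|lra].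
Qed.

(** * Behaviour near zero, by inversion of the variable *)

Definition invert_variable (L : list (R * R)) : list (R * R) :=
  map (fun t => (fst t, - snd t)) L.

Lemma gpoly_invert L x : 0 < x -> gpoly (invert_variable L) x = gpoly L (/ x).
Proof.
  intros Hx. induction L as [|[c e] L IH]; simpl; [reflexivity|].
  rewrite IH. unfold Rpower. rewrite ln_Rinv by assumption.
  do 3 f_equal. ring.
Qed.

Lemma gcoef_invert L e : gcoef (invert_variable L) e = gcoef L (- e).
Proof.
  induction L as [|[c b] L IH]; simpl; [reflexivity|].
  rewrite IH. f_equal.
  destruct (Req_EM_T (- b) e), (Req_EM_T b (- e)); try reflexivity; lra.
Qed.

(** The substitution [x -> 1/x] negates exponents, exchanges 0 with infinity and preserves
    positivity, so this is [gpoly_growth] for the inverted list. *)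
Lemma gpoly_growth_zero L B e :
  (forall x, 0 < x -> 0 < gpoly L x) -> e < B -> gcoef L e <> 0 ->
  exists p c X, p < B /\ 0 < c /\ 0 < X /\
    forall x, 0 < x <= X -> c * Rpower x p <= gpoly L x.
Proof.
  intros Hpos HB He.
  destruct (gpoly_growth (invert_variable L) (- B) (- e)) as (p & c & X & Hp & Hc & HX & H).
  - intros x Hx. rewrite gpoly_invert by assumption. now apply Hpos, Rinv_0_lt_compat.
  - lra.
  - now rewrite gcoef_invert, Ropp_involutive.
  - exists (- p), c, (/ X). repeat split; [lra|assumption|now apply Rinv_0_lt_compat|].
    intros x [Hx HxX].
    assert (Hi : X <= / x).
    { rewrite <- (Rinv_inv X). now apply Rinv_le_contravar. }
    specialize (H (/ x) Hi).
    rewrite gpoly_invert, Rinv_inv in H by now apply Rinv_0_lt_compat.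
    replace (Rpower x (- p)) with (Rpower (/ x) p); [assumption|].
    unfold Rpower. rewrite ln_Rinv by assumption. f_equal. ring.
Qed.

(** * Reduction of the density series to a finite sum *)

Lemma is_derive_density_sum Omega w k z :
  -1 < z ->
  is_derive (density_sum Omega w k) z
    (sum_n (fun i => Omega i * exponent w i * Rpower (1 + z) (exponent w i - 1)) k).
Proof.
  intros Hz. unfold density_sum, density_term.
  apply (is_derive_sum_n (fun i z => Omega i * Rpower (1 + z) (exponent w i))).
  intros i _.
  assert (H : is_derive (fun x => Rpower x (exponent w i)) (1 + z)
                (exponent w i * Rpower (1 + z) (exponent w i - 1))).
  { apply is_derive_Reals, derivable_pt_lim_power. lra. }
  assert (H1 : is_derive (fun z => 1 + z) z 1) by (auto_derive; [exact I|reflexivity]).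
  pose proof (is_derive_scal _ _ (Omega i) _ (is_derive_comp _ _ _ _ _ H H1)) as H2.
  simpl in H2. unfold scal in H2; simpl in H2; unfold mult in H2; simpl in H2.
  replace (Omega i * exponent w i * Rpower (1 + z) (exponent w i - 1))
    with (Omega i * (1 * (exponent w i * Rpower (1 + z) (exponent w i - 1)))) by ring.
  exact H2.
Qed.

Lemma bounded_monomial a p M :
  0 < M -> (forall x, 0 < x -> Rabs (a * Rpower x p) < M) -> a = 0 \/ p = 0.
Proof.
  intros HM Hb.
  destruct (Req_EM_T a 0) as [|Ha]; [now left|].
  destruct (Req_EM_T p 0) as [|Hp]; [now right|exfalso].
  pose proof (Rabs_pos_lt a Ha) as Hpos.
  (* This point solves [|a| x^p = M], against the strict bound. *)
  specialize (Hb (Rpower (M / Rabs a) (/ p)) (exp_pos _)).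
  rewrite Rpower_mult, Rinv_l, Rpower_1 in Hb
    by (try assumption; now apply Rdiv_lt_0_compat).
  rewrite Rabs_mult, (Rabs_pos_eq (M / Rabs a)) in Hb
    by (apply Rlt_le; now apply Rdiv_lt_0_compat).
  replace (Rabs a * (M / Rabs a)) with M in Hb by (field; lra). lra.
Qed.

(** Two consecutive [S_n'] both within 1 of [G] differ by less than 2. Their difference is one
    monomial of exponent [n_i - 1], bounded on the whole half-line, so its coefficient [Omega_i n_i]
    or its exponent vanishes. *)
Lemma large_index_exponent Omega w G :
  derivatives_cv_unif Omega w G ->
  exists K, forall i, (K < i)%nat ->
    Omega i = 0 \/ exponent w i = 0 \/ exponent w i = 1.
Proof.
  intros Hcv. destruct (Hcv (mkposreal 1 Rlt_0_1)) as [K HK]; simpl in HK.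
  (* Since [K < S i], the predecessor [i] still satisfies [K <= i], so the bound holds for both
     partial sums. *)
  exists K. intros [|i] Hi; [lia|].
  destruct (bounded_monomial (Omega (S i) * exponent w (S i)) (exponent w (S i) - 1) 2)
    as [H0|H0]; [lra| |apply Rmult_integral in H0; tauto|right; right; lra].
  intros x Hx.
  pose proof (HK i ltac:(lia) (x - 1) ltac:(lra)) as H1.
  pose proof (HK (S i) ltac:(lia) (x - 1) ltac:(lra)) as H2.
  rewrite (is_derive_unique _ _ _ (is_derive_density_sum Omega w _ (x - 1) ltac:(lra)))
    in H1.
  rewrite (is_derive_unique _ _ _ (is_derive_density_sum Omega w _ (x - 1) ltac:(lra)))
    in H2.
  rewrite sum_Sn in H2. unfold plus in H2; simpl in H2.
  replace (1 + (x - 1)) with x in H1, H2 by ring.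
  apply Rabs_def2 in H1, H2. apply Rabs_def1; lra.
Qed.

(** At [z = 0] every power equals 1. This convergence makes it possible to sum the exponent-0 and
    exponent-1 parts of the tail separately. *)
Lemma is_series_derivative_at_0 Omega w G :
  derivatives_cv_unif Omega w G -> is_series (fun i => Omega i * exponent w i) (G 0).
Proof.
  intros Hcv. change (is_lim_seq (sum_n (fun i => Omega i * exponent w i)) (G 0)).
  apply is_lim_seq_spec. intros eps.
  destruct (Hcv eps) as [K HK]. exists K. intros n Hn.
  specialize (HK n Hn 0 ltac:(lra)).
  rewrite (is_derive_unique _ _ _ (is_derive_density_sum Omega w n 0 ltac:(lra))) in HK.
  erewrite sum_n_ext; [exact HK|].
  intros i; simpl. rewrite Rplus_0_r. unfold Rpower. rewrite ln_1, Rmult_0_r, exp_0. ring.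
Qed.

Lemma gpoly_map_seq (c n : nat -> R) k x :
  gpoly (map (fun i => (c i, n i)) (seq 0 (S k))) x =
  sum_n (fun i => c i * Rpower x (n i)) k.
Proof.
  induction k as [|k IH].
  - rewrite sum_O. simpl. ring.
  - rewrite sum_Sn, seq_S, map_app, gpoly_app, IH. unfold plus; simpl. ring.
Qed.

Lemma gcoef_map_seq (c n : nat -> R) k e :
  gcoef (map (fun i => (c i, n i)) (seq 0 (S k))) e =
  sum_n (fun i => if Req_EM_T (n i) e then c i else 0) k.
Proof.
  induction k as [|k IH].
  - rewrite sum_O. simpl. ring.
  - rewrite sum_Sn, seq_S, map_app, gcoef_app, IH. unfold plus; simpl. ring.
Qed.

Lemma is_series_tail (a : nat -> R) k (l : R) :
  is_series (fun i => a (S k + i)%nat) l -> is_series a (sum_n a k + l).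
Proof.
  intros H. apply is_series_decr_n with (S k); [lia|].
  match goal with |- is_series _ ?m => replace m with l; [exact H|] end.
  change (l = (sum_n a k + l) + - sum_n a k). ring.
Qed.

(** In the tail, [Omega_i = 0], [n_i = 0] or [n_i = 1]. In each case the term equals [(Omega_i -
    Omega_i n_i) + Omega_i n_i (1 + z)], so the tail sums to [c0 + c1 (1 + z)]. *)
Lemma density_is_gpoly Omega w G :
  ex_series Omega -> derivatives_cv_unif Omega w G ->
  exists L,
    (forall z, -1 < z -> is_series (density_term Omega w z) (gpoly L (1 + z))) /\
    (forall e, exponent_coef Omega w e = gcoef L e).
Proof.
  intros Hsum Hcv.
  destruct (large_index_exponent Omega w G Hcv) as [K HK].
  assert (Hb : ex_series (fun i => Omega i * exponent w i))
    by (eexists; now apply (is_series_derivative_at_0 _ _ G)).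
  apply (ex_series_incr_n _ (S K)) in Hb, Hsum. cbv beta in Hb.
  destruct Hb as [c1 Hc1].
  destruct (ex_series_minus _ _ Hsum (ex_intro _ c1 Hc1)) as [c0 Hc0].
  (* Used twice: with weights [1] and [1 + z] for the value of the density, and with the indicators
     of [e = 0] and [e = 1] for its coefficients. *)
  assert (Hlin : forall r s : R, is_series (fun i =>
      r * (Omega (S K + i)%nat - Omega (S K + i)%nat * exponent w (S K + i))
      + s * (Omega (S K + i)%nat * exponent w (S K + i))) (r * c0 + s * c1)).
  { intros r s.
    exact (is_series_plus _ _ _ _
      (@is_series_scal R_AbsRing R_NormedModule r _ _ Hc0)
      (@is_series_scal R_AbsRing R_NormedModule s _ _ Hc1)). }
  exists (map (fun i => (Omega i, exponent w i)) (seq 0 (S K)) ++ (c0, 0) :: (c1, 1) :: nil).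
  split.
  - intros z Hz. rewrite gpoly_app, gpoly_map_seq. simpl gpoly.
    rewrite Rpower_O, Rpower_1 by lra.
    apply is_series_tail.
    replace (c0 * 1 + (c1 * (1 + z) + 0)) with (1 * c0 + (1 + z) * c1) by ring.
    eapply is_series_ext; [|apply Hlin].
    intros i. unfold density_term.
    (* The equality is typed in the carrier of a normed module; restating it in [R] lets the
       real-number tactics apply. *)
    match goal with |- ?u = ?v => change (@eq R u v) end.
    destruct (HK (S K + i)%nat ltac:(lia)) as [H|[H|H]]; rewrite H;
      rewrite ?Rpower_O, ?Rpower_1 by lra; ring.
  - intros e. rewrite gcoef_app, gcoef_map_seq.
    apply is_series_unique, is_series_tail. simpl gcoef.
    replace ((if Req_EM_T 0 e then c0 else 0) + ((if Req_EM_T 1 e then c1 else 0) + 0))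
      with ((if Req_EM_T 0 e then 1 else 0) * c0 + (if Req_EM_T 1 e then 1 else 0) * c1)
      by (destruct (Req_EM_T 0 e), (Req_EM_T 1 e); ring).
    eapply is_series_ext; [|apply Hlin].
    intros i.
    match goal with |- ?u = ?v => change (@eq R u v) end.
    destruct (HK (S K + i)%nat ltac:(lia)) as [H|[H|H]]; rewrite H;
      destruct (Req_EM_T 0 e), (Req_EM_T 1 e); try lra;
      destruct (Req_EM_T _ e); lra.
Qed.

(** * Primitive of a positive continuous function on [(-1, oo)] *)

Lemma is_derive_continuity_pt (g : R -> R) (x l : R) : is_derive g x l -> continuity_pt g x.
Proof. intros Hg. apply derivable_continuous_pt. exists l. now apply is_derive_Reals. Qed.

Section PositiveDensity.

Variable f : R -> R.
Hypothesis f_cont : forall z, -1 < z -> continuous f z.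
Hypothesis f_pos : forall z, -1 < z -> 0 < f z.

(** The base point 0 is interior to [(-1, oo)], so both improper ends are reached as limits of one
    primitive. *)
Let F (z : R) : R := RInt f 0 z.

Lemma ex_RInt_density a b : -1 < a -> -1 < b -> ex_RInt f a b.
Proof.
  intros Ha Hb. apply (ex_RInt_continuous (V := R_CompleteNormedModule)).
  intros z [Hz _]. apply f_cont.
  apply Rlt_le_trans with (2 := Hz). now apply Rmin_glb_lt.
Qed.

Lemma is_RInt_density a b : -1 < a -> -1 < b -> is_RInt f a b (F b - F a).
Proof.
  intros Ha Hb. unfold F.
  assert (H0 : -1 < 0) by lra.
  replace (RInt f 0 b - RInt f 0 a) with (RInt f a b).
  { apply (RInt_correct (V := R_CompleteNormedModule)). now apply ex_RInt_density. }
  assert (HC : RInt f 0 a + RInt f a b = RInt f 0 b)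
    by (apply (RInt_Chasles f 0 a b); now apply ex_RInt_density).
  lra.
Qed.

Lemma is_derive_primitive z : -1 < z -> is_derive F z (f z).
Proof.
  intros Hz. apply (is_derive_RInt f F 0); [|now apply f_cont].
  apply (filter_imp (fun y => -1 < y)).
  - intros y Hy. apply (RInt_correct (V := R_CompleteNormedModule)).
    apply ex_RInt_density; lra.
  - now apply (open_gt (-1)).
Qed.

Lemma primitive_lt a b : -1 < a -> a < b -> F a < F b.
Proof.
  intros Ha Hab.
  assert (Hr : 0 < RInt f a b).
  { apply RInt_gt_0; [assumption| |].
    - intros x Hx. apply f_pos. lra.
    - intros x Hx. apply f_cont. lra. }
  rewrite (is_RInt_unique _ _ _ _ (is_RInt_density a b Ha ltac:(lra))) in Hr. lra.
Qed.

(** [F] minus the primitive of [C (1 + z)^(-s)] has nonpositive derivative on [[a, b]]; the mean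
    value theorem concludes. The condition [s <> 1] excludes a logarithm. *)
Lemma primitive_power_bound C s a b :
  -1 < a -> a <= b -> s <> 1 ->
  (forall z, a <= z <= b -> f z <= C * Rpower (1 + z) (- s)) ->
  F b - F a <= C / (1 - s) * (Rpower (1 + b) (1 - s) - Rpower (1 + a) (1 - s)).
Proof.
  intros Ha Hab Hs Hle.
  assert (Hd : forall z, -1 < z ->
    is_derive (fun z => F z - C / (1 - s) * Rpower (1 + z) (1 - s)) z
      (f z - C * Rpower (1 + z) (- s))).
  { intros z Hz.
    apply (is_derive_minus F _ z (f z)); [now apply is_derive_primitive|].
    replace (C * Rpower (1 + z) (- s))
      with (C / (1 - s) * (1 * ((1 - s) * Rpower (1 + z) (1 - s - 1)))).
    2:{ replace (1 - s - 1) with (- s) by ring. field. lra. }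
    apply (is_derive_scal (fun z => Rpower (1 + z) (1 - s))).
    apply (is_derive_comp (fun x => Rpower x (1 - s)) (fun z => 1 + z)).
    - apply is_derive_Reals, derivable_pt_lim_power. lra.
    - auto_derive; [exact I|reflexivity]. }
  destruct (MVT_gen (fun z => F z - C / (1 - s) * Rpower (1 + z) (1 - s)) a b
              (fun z => f z - C * Rpower (1 + z) (- s))) as (c & Hc & Heq).
  - rewrite Rmin_left, Rmax_right by assumption. intros z Hz. apply Hd. lra.
  - rewrite Rmin_left, Rmax_right by assumption. intros z Hz.
    eapply is_derive_continuity_pt, Hd. lra.
  - rewrite Rmin_left, Rmax_right in Hc by assumption. specialize (Hle c Hc).
    assert (Hneg : (f c - C * Rpower (1 + c) (- s)) * (b - a) <= 0).
    { rewrite <- (Rmult_0_l (b - a)). apply Rmult_le_compat_r; lra. }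
    rewrite <- Heq in Hneg. lra.
Qed.

Lemma power_bound_const_nonneg C s z :
  -1 < z -> f z <= C * Rpower (1 + z) (- s) -> 0 <= C.
Proof.
  intros Hz Hle. pose proof (f_pos z Hz). pose proof (exp_pos (- s * ln (1 + z))) as He.
  apply Rnot_lt_le. intros HC.
  assert (C * Rpower (1 + z) (- s) < 0); [|lra].
  rewrite <- (Rmult_0_l (Rpower (1 + z) (- s))). now apply Rmult_lt_compat_r.
Qed.

Lemma primitive_bounded_above C s X :
  -1 < X -> 1 < s -> (forall z, X <= z -> f z <= C * Rpower (1 + z) (- s)) ->
  exists M, forall z, -1 < z -> F z <= M.
Proof.
  intros HX Hs Hle.
  pose proof (power_bound_const_nonneg C s X HX (Hle X (Rle_refl X))) as HC.
  exists (F X + C / (s - 1) * Rpower (1 + X) (1 - s)). intros z Hz.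
  assert (Hk : 0 <= C / (s - 1)).
  { apply Rmult_le_pos; [assumption|]. apply Rlt_le, Rinv_0_lt_compat. lra. }
  assert (Hnn : forall y, 0 <= C / (s - 1) * Rpower (1 + y) (1 - s)).
  { intros y. apply Rmult_le_pos; [assumption|apply Rlt_le, exp_pos]. }
  destruct (Rle_or_lt X z) as [HXz|HzX].
  - pose proof (primitive_power_bound C s X z HX HXz ltac:(lra)
                  (fun y Hy => Hle y (proj1 Hy))) as Hb.
    replace (C / (1 - s)) with (- (C / (s - 1))) in Hb by (field; lra).
    specialize (Hnn z). lra.
  - pose proof (primitive_lt z X Hz HzX). specialize (Hnn X). lra.
Qed.

(** Mirror image at the left end: [s < 1] gives the droppable term the favourable sign there. *)
Lemma primitive_bounded_below C s X :
  -1 < X -> s < 1 -> (forall z, -1 < z <= X -> f z <= C * Rpower (1 + z) (- s)) ->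
  exists M, forall z, -1 < z -> M <= F z.
Proof.
  intros HX Hs Hle.
  pose proof (power_bound_const_nonneg C s X HX (Hle X ltac:(lra))) as HC.
  exists (F X - C / (1 - s) * Rpower (1 + X) (1 - s)). intros z Hz.
  assert (Hk : 0 <= C / (1 - s)).
  { apply Rmult_le_pos; [assumption|]. apply Rlt_le, Rinv_0_lt_compat. lra. }
  assert (Hnn : forall y, 0 <= C / (1 - s) * Rpower (1 + y) (1 - s)).
  { intros y. apply Rmult_le_pos; [assumption|apply Rlt_le, exp_pos]. }
  destruct (Rle_or_lt z X) as [HzX|HXz].
  - pose proof (primitive_power_bound C s z X Hz HzX ltac:(lra)
                  (fun y Hy => Hle y ltac:(lra))) as Hb.
    specialize (Hnn z). lra.
  - pose proof (primitive_lt X z HX HXz). specialize (Hnn X). lra.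
Qed.

(** The limit is the supremum of [F], never attained because [F] keeps increasing. *)
Lemma primitive_lim_infty M :
  (forall z, -1 < z -> F z <= M) ->
  exists L, filterlim F (Rbar_locally p_infty) (locally L) /\
    forall z, -1 < z -> F z < L.
Proof.
  intros HM.
  destruct (completeness (fun y => exists z, -1 < z /\ y = F z)) as [L [Hub Hlub]].
  { exists M. intros y (z & Hz & ->). now apply HM. }
  { exists (F 0), 0. split; [lra|reflexivity]. }
  assert (Hlt : forall z, -1 < z -> F z < L).
  { intros z Hz. apply Rlt_le_trans with (F (z + 1)); [apply primitive_lt; lra|].
    apply Hub. exists (z + 1). split; [lra|reflexivity]. }
  exists L. split; [|exact Hlt].
  apply filterlim_locally. intros eps.
  destruct (classic (exists z, -1 < z /\ L - eps < F z)) as [(z & Hz & Hzl)|Hno].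
  - exists z. intros y Hy.
    pose proof (primitive_lt z y Hz Hy). pose proof (Hlt y ltac:(lra)).
    apply Rabs_def1; unfold minus, plus, opp; simpl; lra.
  - exfalso. assert (L <= L - eps); [|pose proof (cond_pos eps); lra].
    apply Hlub. intros y (z & Hz & ->). apply Rnot_lt_le. intros Hzl.
    apply Hno. now exists z.
Qed.

Lemma primitive_lim_left M :
  (forall z, -1 < z -> M <= F z) ->
  exists L, filterlim F (at_right (-1)) (locally L) /\
    forall z, -1 < z -> L < F z.
Proof.
  intros HM.
  (* The infimum of [F] is obtained as minus the supremum of [- F]. *)
  destruct (completeness (fun y => exists z, -1 < z /\ y = - F z)) as [L [Hub Hlub]].
  { exists (- M). intros y (z & Hz & ->). specialize (HM z Hz). lra. }
  { exists (- F 0), 0. split; [lra|reflexivity]. }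
  assert (Hlt : forall z, -1 < z -> - L < F z).
  { intros z Hz. apply Rle_lt_trans with (F ((z - 1) / 2)); [|apply primitive_lt; lra].
    assert (- F ((z - 1) / 2) <= L); [|lra].
    apply Hub. exists ((z - 1) / 2). split; [lra|reflexivity]. }
  exists (- L). split; [|exact Hlt].
  apply filterlim_locally. intros eps.
  destruct (classic (exists z, -1 < z /\ F z < - L + eps)) as [(z & Hz & Hzl)|Hno].
  - assert (Hd : 0 < z - (-1)) by lra. exists (mkposreal _ Hd). intros y Hyz Hy.
    apply Rabs_def2 in Hyz. unfold minus, plus, opp in Hyz; simpl in Hyz.
    pose proof (primitive_lt y z Hy ltac:(lra)). pose proof (Hlt y Hy).
    apply Rabs_def1; unfold minus, plus, opp; simpl; lra.
  - exfalso. assert (L <= L - eps); [|pose proof (cond_pos eps); lra].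
    apply Hlub. intros y (z & Hz & ->). apply Rnot_lt_le. intros Hzl.
    apply Hno. exists z. lra.
Qed.

(** General filters at both ends cover both horizons: [at_point z] is the lower end for one and the
    upper end for the other. *)
Lemma is_RInt_gen_primitive Fa Fb {FFa : Filter Fa} {FFb : Filter Fb} la lb :
  Fa (fun z => -1 < z) -> Fb (fun z => -1 < z) ->
  filterlim F Fa (locally la) -> filterlim F Fb (locally lb) ->
  is_RInt_gen f Fa Fb (lb - la).
Proof.
  intros Ha Hb Hla Hlb P HP.
  assert (Hlim : filterlim (fun ab => minus (F (snd ab)) (F (fst ab)))
                   (filter_prod Fa Fb) (locally (lb - la))).
  { apply (filterlim_comp_2 (G := locally lb) (H := locally (opp la))
             (fun ab => F (snd ab)) (fun ab => opp (F (fst ab))) plus).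
    - apply filterlim_comp with (2 := Hlb). apply filterlim_snd.
    - apply filterlim_comp with (G := locally la);
        [apply filterlim_comp with (2 := Hla); apply filterlim_fst|].
      apply (filterlim_opp (V := R_NormedModule)).
    - apply (filterlim_plus (V := R_NormedModule)). }
  specialize (Hlim P HP). unfold filtermap in Hlim.
  unfold filtermapi.
  apply (filter_imp (fun ab => (-1 < fst ab /\ -1 < snd ab) /\
                               P (minus (F (snd ab)) (F (fst ab))))).
  - intros [a b] [[Ha' Hb'] HPab]. eexists. split; [|exact HPab].
    now apply is_RInt_density.
  - apply filter_and; [|exact Hlim].
    exists (fun z => -1 < z) (fun z => -1 < z); auto.
Qed.

Lemma filterlim_at_point (z : R) : filterlim F (at_point z) (locally (F z)).
Proof. intros P HP. exact (locally_singleton _ _ HP). Qed.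

Lemma primitive_attains y a b :
  -1 < a -> a < b -> F a < y < F b -> exists z, a < z < b /\ F z = y.
Proof.
  intros Ha Hab Hy.
  destruct (IVT_Rbar_incr F a b (F a) (F b) y) as (z & Hza & Hzb & Hz).
  - eapply is_lim_continuity, is_derive_continuity_pt, is_derive_primitive. lra.
  - eapply is_lim_continuity, is_derive_continuity_pt, is_derive_primitive. lra.
  - intros x Hxa Hxb. simpl in Hxa, Hxb.
    eapply is_derive_continuity_pt, is_derive_primitive. lra.
  - exact Hab.
  - exact Hy.
  - exists z. simpl in Hza, Hzb. lra.
Qed.

End PositiveDensity.

(** * Existence and crossing of the horizons *)

Lemma horizons_cross (H : R -> R) :
  (forall z, -1 < z -> continuous (fun x => / H x) z) ->
  (forall z, -1 < z -> 0 < / H z) ->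
  (exists C s X, -1 < X /\ 1 < s /\
     forall z, X <= z -> / H z <= C * Rpower (1 + z) (- s)) ->
  (exists C s X, -1 < X /\ s < 1 /\
     forall z, -1 < z <= X -> / H z <= C * Rpower (1 + z) (- s)) ->
  (forall z, -1 < z -> particle_horizon_exists H z /\ event_horizon_exists H z) /\
  exists! z0, -1 < z0 /\
    (forall z, z0 < z -> event_horizon H z > particle_horizon H z) /\
    event_horizon H z0 = particle_horizon H z0 /\
    (forall z, -1 < z < z0 -> event_horizon H z < particle_horizon H z).
Proof.
  intros Hcont Hpos (C & s & X & HX & Hs & Htop) (C' & s' & X' & HX' & Hs' & Hbot).
  destruct (primitive_bounded_above _ Hcont Hpos C s X HX Hs Htop) as [M HM].
  destruct (primitive_bounded_below _ Hcont Hpos C' s' X' HX' Hs' Hbot) as [M' HM'].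
  destruct (primitive_lim_infty _ Hcont Hpos M HM) as (L & HL & HltL).
  destruct (primitive_lim_left _ Hcont Hpos M' HM') as (L' & HL' & HltL').
  set (F := fun z => RInt (fun x => / H x) 0 z) in *.
  assert (Hmono : forall a b, -1 < a -> a < b -> F a < F b)
    by exact (primitive_lt _ Hcont Hpos).
  assert (Hright : at_right (-1) (fun z => -1 < z)).
  { exists (mkposreal 1 Rlt_0_1). now intros. }
  assert (Hinf : Rbar_locally p_infty (fun z => -1 < z)) by now exists (-1).
  assert (HIp : forall z, -1 < z ->
    is_RInt_gen (fun x => / H x) (at_point z) (Rbar_locally p_infty) (L - F z)).
  { intros z Hz. apply is_RInt_gen_primitive; try assumption; try typeclasses eauto.
    apply filterlim_at_point. }
  assert (HIe : forall z, -1 < z ->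
    is_RInt_gen (fun x => / H x) (at_right (-1)) (at_point z) (F z - L')).
  { intros z Hz. apply is_RInt_gen_primitive; try assumption; try typeclasses eauto.
    apply filterlim_at_point. }
  assert (Hp : forall z, -1 < z -> particle_horizon H z = / (1 + z) * (L - F z)).
  { intros z Hz. unfold particle_horizon. f_equal.
    apply (is_RInt_gen_unique (V := R_CompleteNormedModule)). now apply HIp. }
  assert (He : forall z, -1 < z -> event_horizon H z = / (1 + z) * (F z - L')).
  { intros z Hz. unfold event_horizon. f_equal.
    apply (is_RInt_gen_unique (V := R_CompleteNormedModule)). now apply HIe. }
  split; [intros z Hz; split; eexists; [now apply HIp|now apply HIe]|].
  (* With [L'] and [L] the limits of [F] at -1 and infinity, the horizons agree exactly where [F]
     takes the value midway between them. *)
  assert (HLL : L' < (L' + L) / 2 < L).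
  { pose proof (HltL 0 ltac:(lra)). pose proof (HltL' 0 ltac:(lra)). lra. }
  (* The two limits supply [a] with [F a] below the midway value and then [b > a] with [F b] above
     it, as the intermediate value theorem requires. *)
  destruct (filter_ex (F := at_right (-1)) _
    (filter_and _ _ Hright (HL' _ (open_lt ((L' + L) / 2) L' (proj1 HLL))))) as (a & Ha & HFa).
  destruct (filter_ex (F := Rbar_locally p_infty) _
    (filter_and (F := Rbar_locally p_infty) _ _
      (ex_intro _ a (fun x Hx => Hx) : Rbar_locally p_infty (fun x => a < x))
      (HL _ (open_gt ((L' + L) / 2) L (proj2 HLL))))) as (b & Hab & HFb).
  destruct (primitive_attains _ Hcont ((L' + L) / 2) a b Ha Hab (conj HFa HFb))
    as (z0 & Hz0 & HFz0).
  change (F z0 = (L' + L) / 2) in HFz0.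
  assert (Hi : forall z, -1 < z -> 0 < / (1 + z)).
  { intros z Hz. apply Rinv_0_lt_compat. lra. }
  assert (Hgt : forall z, z0 < z -> event_horizon H z > particle_horizon H z).
  { intros z Hz. rewrite Hp, He by lra. apply Rmult_lt_compat_l; [apply Hi; lra|].
    pose proof (Hmono z0 z ltac:(lra) Hz). lra. }
  assert (Hlt : forall z, -1 < z < z0 -> event_horizon H z < particle_horizon H z).
  { intros z Hz. rewrite Hp, He by lra. apply Rmult_lt_compat_l; [apply Hi; lra|].
    pose proof (Hmono z z0 ltac:(lra) ltac:(lra)). lra. }
  exists z0. split.
  - split; [lra|]. split; [exact Hgt|]. split; [|exact Hlt].
    rewrite Hp, He by lra. f_equal. lra.
  - intros z1 (Hz1 & _ & Heq & _).
    destruct (Rtotal_order z0 z1) as [Hl|[Hq|Hl]]; [|exact Hq|].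
    + specialize (Hgt z1 Hl). lra.
    + specialize (Hlt z1 (conj Hz1 Hl)). lra.
Qed.

(** * Application to the Hubble parameter *)

Lemma ex_derive_gpoly L x : 0 < x -> ex_derive (gpoly L) x.
Proof.
  intros Hx. induction L as [|[c e] L IH].
  - apply (ex_derive_const (V := R_NormedModule)).
  - apply (ex_derive_plus (V := R_NormedModule) (fun x => c * Rpower x e) (gpoly L) x);
      [|exact IH].
    apply ex_derive_scal. eexists. apply is_derive_Reals.
    now apply derivable_pt_lim_power.
Qed.

(** The square root halves the exponent, so the threshold 2 for the density becomes the
    integrability threshold 1 for [1/H]. *)
Lemma inv_sqrt_power_bound h c p x y :
  0 < h -> 0 < c -> c * Rpower x p <= y ->
  / (h * sqrt y) <= / (h * sqrt c) * Rpower x (- (p / 2)).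
Proof.
  intros Hh Hc Hy.
  assert (Hsqrt : sqrt (Rpower x p) = Rpower x (p / 2)).
  { rewrite <- Rpower_sqrt by apply exp_pos. now rewrite Rpower_mult. }
  pose proof (sqrt_lt_R0 c Hc) as Hsc.
  pose proof (exp_pos (p / 2 * ln x)) as He. fold (Rpower x (p / 2)) in He.
  rewrite Rpower_Ropp, <- Rinv_mult. apply Rinv_le_contravar.
  - repeat apply Rmult_lt_0_compat; assumption.
  - rewrite Rmult_assoc. apply Rmult_le_compat_l; [lra|].
    rewrite <- Hsqrt, <- sqrt_mult_alt by lra. now apply sqrt_le_1_alt.
Qed.

(** Otherwise [B] would bound all appearing exponents, hence their least upper bound. The argument
    also covers an infinite supremum. *)
Lemma highest_exponent_gt Omega w (B : R) :
  Rbar_lt B (highest_exponent Omega w) -> exists e, B < e /\ appears Omega w e.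
Proof.
  intros HB. apply NNPP. intros Hno.
  apply (Rbar_lt_not_le _ _ HB), Lub_Rbar_correct.
  intros e He. apply Rnot_lt_le. intros Hlt. apply Hno. now exists e.
Qed.

Lemma lowest_exponent_lt Omega w (B : R) :
  Rbar_lt (lowest_exponent Omega w) B -> exists e, e < B /\ appears Omega w e.
Proof.
  intros HB. apply NNPP. intros Hno.
  apply (Rbar_lt_not_le _ _ HB), Glb_Rbar_correct.
  intros e He. apply Rnot_lt_le. intros Hlt. apply Hno. now exists e.
Qed.

Theorem theorem6p5 (H0 : R) (Omega w : nat -> R) (G : R -> R)
  (H0_pos : 0 < H0)
  (curvature : exists i : nat, exponent w i = 2)
  (sum_Omega : is_series Omega 1)
  (hubble_pos : forall z : R, -1 < z -> 0 < hubble H0 Omega w z)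
  (dS_cv : derivatives_cv_unif Omega w G)
  (N_gt2 : Rbar_lt 2 (highest_exponent Omega w))
  (m_lt2 : Rbar_lt (lowest_exponent Omega w) 2) :
  let H := hubble H0 Omega w in
  let Hp := particle_horizon H in
  let He := event_horizon H in
  (forall z : R, -1 < z ->
     particle_horizon_exists H z /\ event_horizon_exists H z) /\
  exists! z0 : R,
    -1 < z0 /\
    (forall z : R, z0 < z -> He z > Hp z) /\
    He z0 = Hp z0 /\
    (forall z : R, -1 < z < z0 -> He z < Hp z).
Proof.
  intros H Hp He.
  destruct (density_is_gpoly Omega w G (ex_intro _ 1 sum_Omega) dS_cv) as (L & HL & Hcoef).
  assert (HH : forall z, -1 < z -> H z = H0 * sqrt (gpoly L (1 + z))).
  { intros z Hz. unfold H, hubble. do 2 f_equal. now apply is_series_unique, HL. }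
  assert (Hpos : forall x, 0 < x -> 0 < gpoly L x).
  (* [sqrt] returns 0 at nonpositive arguments, so a nonpositive density would make [H] vanish. *)
  { intros x Hx. apply Rnot_le_lt. intros Hle.
    pose proof (hubble_pos (x - 1) ltac:(lra)) as Hh. fold H in Hh.
    rewrite HH in Hh by lra. replace (1 + (x - 1)) with x in Hh by ring.
    rewrite sqrt_neg_0 in Hh by assumption. lra. }
  apply horizons_cross.
  (* The finite formula for [H] is known only on [(-1, oo)], so it is substituted on a neighbourhood
     of [z]. *)
  - intros z Hz. apply (continuous_ext_loc _ (fun y => / (H0 * sqrt (gpoly L (1 + y))))).
    { apply (filter_imp (fun y => -1 < y)); [|now apply (open_gt (-1))].
      intros y Hy. now rewrite HH. }
    assert (H1z : 0 < gpoly L (1 + z)) by (apply Hpos; lra).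
    apply (ex_derive_continuous (V := R_NormedModule)).
    pose proof (ex_derive_gpoly L (1 + z) ltac:(lra)).
    pose proof (sqrt_lt_R0 _ H1z).
    auto_derive. repeat split; try assumption.
    apply Rgt_not_eq. now apply Rmult_lt_0_compat.
  - intros z Hz. now apply Rinv_0_lt_compat, hubble_pos.
  - destruct (highest_exponent_gt Omega w 2 N_gt2) as (e & He2 & Hap).
    unfold appears in Hap. rewrite Hcoef in Hap.
    destruct (gpoly_growth L 2 e Hpos He2 Hap) as (p & c & X & Hp2 & Hc & HX & Hb).
    (* The shift [X - 1] returns from [x = 1 + z] to [z], and [p > 2] gives [p / 2 > 1]. *)
    exists (/ (H0 * sqrt c)), (p / 2), (X - 1). repeat split; [lra|lra|].
    intros z Hz. rewrite HH by lra.
    apply inv_sqrt_power_bound; [assumption|assumption|apply Hb; lra].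
  - destruct (lowest_exponent_lt Omega w 2 m_lt2) as (e & He2 & Hap).
    unfold appears in Hap. rewrite Hcoef in Hap.
    destruct (gpoly_growth_zero L 2 e Hpos He2 Hap) as (p & c & X & Hp2 & Hc & HX & Hb).
    exists (/ (H0 * sqrt c)), (p / 2), (X - 1). repeat split; [lra|lra|].
    intros z Hz. rewrite HH by lra.
    apply inv_sqrt_power_bound; [assumption|assumption|apply Hb; lra].
Qed.
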